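(* For every $n\ge 2$ the path $P_n$ on $n$ vertices is eligible, and $\operatorname{mv}(P_n)\to 2$ as $n \to \infty$.
   Context: Graphs are finite and simple. For a graph $G$ on $n$ vertices, $\mathcal{S}_L(G)$ denotes the set of $n\times n$ real symmetric matrices $A=[a_{i,j}]$ such that $a_{i,j}<0$ if $\{i,j\}\in E(G)$, $a_{i,j}=0$ if $i\neq j$ and $\{i,j\}\notin E(G)$, and $a_{i,i}=-\sum_{k\neq i}a_{i,k}$ for all $i$. Let $\mathcal{S}^s_L(G)=\{A\in\mathcal{S}_L(G):\operatorname{tr}(A)=2|E(G)|\}$. For $A\in\mathcal{S}_L(G)$ with spectrum $\{0,\lambda_2,\ldots,\lambda_n\}$ put $\mathbb{E}(A)=\frac{1}{n-1}\sum_{i=2}^n\lambda_i$ and $\operatorname{Var}(A)=\frac{1}{n-1}\sum_{i=2}^n(\lambda_i-\mathbb{E}(A))^2$. The minimum variance of $G$ is $\operatorname{mv}(G)=\inf\{\operatorname{Var}(A):A\in\mathcal{S}^s_L(G)\}$. The line graph of $G$ has vertex set $E(G)$, two distinct edges being adjacent when they share a vertex. Let $M_2=4I+B$, where $B$ is the adjacency matrix of the line graph of $G$ ($M_2$ is positive definite). $G$ is called eligible if $M_2^{-1}\mathbf{1}$ is entrywise positive, where $\mathbf{1}$ is the all-ones vector. *)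

(* Defs.v *)
(* MathComp and MathComp-Analysis, over an arbitrary [R : realType]. *)
From mathcomp Require Import all_boot all_order all_algebra.
From mathcomp Require Import all_classical all_reals all_analysis.

Set Implicit Arguments.
Unset Strict Implicit.
Unset Printing Implicit Defensive.

Import Order.TTheory GRing.Theory Num.Theory.
Import numFieldNormedType.Exports.

Local Open Scope ring_scope.

Record sgraph (n : nat) := SGraph {
  adj :> rel 'I_n;
  adj_sym : symmetric adj;
  adj_irr : irreflexive adj }.

Definition edges (n : nat) (G : sgraph n) : {set {set 'I_n}} :=
  [set [set p.1; p.2] | p in [pred p : 'I_n * 'I_n | G p.1 p.2]]%SET.

Definition path_rel (n : nat) : rel 'I_n :=
  fun i j => (i.+1 == j :> nat) || (j.+1 == i :> nat).

Fact path_rel_sym (n : nat) : symmetric (@path_rel n).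
Proof. by move=> i j; rewrite /path_rel orbC. Qed.

Fact path_rel_irr (n : nat) : irreflexive (@path_rel n).
Proof. by move=> i; rewrite /path_rel orbb eqn_leq ltnn. Qed.

Definition path_graph (n : nat) : sgraph n :=
  SGraph (@path_rel_sym n) (@path_rel_irr n).

(* The vertex [k : 'I_#|edges G|] stands for the edge [enum_val k]. *)
Definition line_rel (n : nat) (G : sgraph n) : rel 'I_#|edges G| :=
  fun k l => (k != l) && (enum_val k :&: enum_val l != finset.set0)%SET.

Fact line_rel_sym (n : nat) (G : sgraph n) : symmetric (line_rel (G := G)).
Proof. by move=> k l; rewrite /line_rel eq_sym finset.setIC. Qed.

Fact line_rel_irr (n : nat) (G : sgraph n) : irreflexive (line_rel (G := G)).
Proof. by move=> k; rewrite /line_rel eqxx. Qed.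

Definition line_graph (n : nat) (G : sgraph n) : sgraph #|edges G| :=
  SGraph (@line_rel_sym n G) (@line_rel_irr n G).

Definition adjacency_mx (R : realType) (n : nat) (G : sgraph n) : 'M[R]_n :=
  \matrix_(i, j) (G i j)%:R.

Definition M2 (R : realType) (n : nat) (G : sgraph n) : 'M[R]_#|edges G| :=
  4%:M + adjacency_mx R (line_graph G).

(* [invmx] is the true inverse here: with [N] the vertex-edge incidence matrix,
   [M2] is [2 I + N^T N], which is positive definite. *)
Definition eligible (R : realType) (n : nat) (G : sgraph n) : Prop :=
  forall k : 'I_#|edges G|,
    0 < (invmx (M2 R G) *m const_mx 1 : 'cV[R]_#|edges G|) k ord0.

Local Open Scope classical_set_scope.

Definition SL (R : realType) (n : nat) (G : sgraph n) : set 'M[R]_n :=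
  [set A | [/\ A^T = A,
    forall i j, G i j -> A i j < 0,
    forall i j, i != j -> ~~ G i j -> A i j = 0
    & forall i, A i i = - \sum_(k | k != i) A i k]].

Definition SLs (R : realType) (n : nat) (G : sgraph n) : set 'M[R]_n :=
  [set A | SL G A /\ \tr A = (2 * #|edges G|)%:R].

(* The nondecreasing list of the eigenvalues, repeated according to their
   multiplicity in the characteristic polynomial.  It exists as soon as this
   polynomial splits over [R], in particular when [A] is symmetric; otherwise
   [spectrum A] is the junk value [[::]]. *)
Definition spectrum (R : realType) (n : nat) (A : 'M[R]_n) : seq R :=
  xget [::] [set s : seq R | sorted <=%R s /\
                             char_poly A = \prod_(x <- s) ('X - x%:P)].

(* For [A] in [SL G], [0] is an eigenvalue, and [rem] deletes one occurrence
   of it. *)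
Definition nontriv_eigenvalues (R : realType) (n : nat) (A : 'M[R]_n) : seq R :=
  rem 0 (spectrum A).

Definition mean_eig (R : realType) (n : nat) (A : 'M[R]_n) : R :=
  (n.-1)%:R^-1 * \sum_(x <- nontriv_eigenvalues A) x.

Definition Var (R : realType) (n : nat) (A : 'M[R]_n) : R :=
  (n.-1)%:R^-1 * \sum_(x <- nontriv_eigenvalues A) (x - mean_eig A) ^+ 2.

Definition mv (R : realType) (n : nat) (G : sgraph n) : R :=
  inf [set Var A | A in SLs (R := R) G].

(* Main.v *)
Require Import Defs.
From mathcomp Require Import all_boot all_order all_algebra.
From mathcomp Require Import all_classical all_reals all_analysis.
From mathcomp Require Import complex.
From mathcomp Require Import ring lra zify.

Set Implicit Arguments.
Unset Strict Implicit.
Unset Printing Implicit Defensive.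

Import Order.TTheory GRing.Theory Num.Theory.
Import numFieldNormedType.Exports.

Local Open Scope classical_set_scope.
Local Open Scope ring_scope.

(** Variance. Summing squares over the spectrum gives
    [Var A = \tr (A *m A) / (n - 1) - (\tr A / (n - 1)) ^ 2] for every
    weighted Laplacian [A] ([Var_trace]); the eigenvalue [0] that is left out
    contributes to neither power sum. This needs the characteristic polynomial
    of a real symmetric matrix to split over the reals, which comes from
    unitary diagonalisation over the complex numbers ([spectral_real_sym]).

    Let [e] be the number of edges and [\tr A = 2 * e]. Write each entry as
    its deviation from a target: [2] on the diagonal, [-1] on the edges. The
    squares of the deviations are nonnegative, so [\tr (A *m A)] is at least
    an affine function of the entries, and the zero row sums turn that function
    into [10 * e - 4 * n] ([tr_sqr_ge]). For a graph with [n - 1] edges the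
    fixed mean is [2], and the variance is at least [2 - 4 / (n - 1)]
    ([mv_ge]). The combinatorial Laplacian almost meets the target: if no
    degree exceeds [2] then the sum of the squared degrees is at most [4 * e],
    and its variance is at most [2] ([mv_le]). The path is squeezed between
    these two bounds.

    Eligibility. In the line graph of a path every vertex has at most two
    neighbours, so [M2] is [4 I] plus a nonnegative matrix whose row sums are
    at most [2]. Such a matrix is strictly diagonally dominant, and a solution
    [y] of [M2 y = 1] is located by bootstrapping: [|y| <= 1 / 2] by
    dominance, hence [y >= 0], hence [y <= 1 / 4], hence [y >= 1 / 8]
    ([four_plus_pos]). *)

(** * Spectra of real symmetric matrices *)

Lemma char_poly_conj (F : fieldType) (n : nat) (P A : 'M[F]_n) :
  P \in unitmx -> char_poly (invmx P *m A *m P) = char_poly A.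
Proof.
move=> uP; have uPX : map_mx polyC P \in unitmx by rewrite map_unitmx.
rewrite /char_poly.
have -> : char_poly_mx (invmx P *m A *m P) =
    invmx (map_mx polyC P) *m char_poly_mx A *m map_mx polyC P.
  rewrite /char_poly_mx !map_mxM map_invmx mulmxBr mulmxBl.
  rewrite (_ : _ *m _%:M *m _ = 'X%:M) // [_ *m _%:M]scalar_mxC -mulmxA.
  by rewrite mulVmx ?mulmx1.
by rewrite !det_mulmx mulrAC -det_mulmx mulVmx ?det1 ?mul1r.
Qed.

(** Over [R[i]] a real symmetric matrix is normal and hermitian, so it is
    unitarily similar to a diagonal matrix with real entries; the
    characteristic polynomial and the traces are similarity invariants and
    descend to [R]. *)
Lemma spectral_real_sym (R : rcfType) (n : nat) (A : 'M[R]_n) :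
  A^T = A -> exists d : 'rV[R]_n,
    [/\ char_poly A = \prod_i ('X - (d ord0 i)%:P),
        \tr A = \sum_i d ord0 i
      & \tr (A *m A) = \sum_i d ord0 i ^+ 2].
Proof.
move=> symA; pose B : 'M[R[i]]_n := map_mx (real_complex R) A.
have realB : B \is a mxOver Num.real.
  by apply/mxOverP => i j; rewrite mxE; apply/complex_realP; exists (A i j).
have symB : B \is symmetricmx.
  by apply/is_hermitianmxP; rewrite expr0 scale1r map_mx_id // /B map_trmx symA.
have /orthomx_spectralP := symmetric_normalmx symB realB.
have := hermitian_spectral_diag_real (realsym_hermsym symB realB).
have := spectral_unit B.
move: (spectralmx B) (spectral_diag B) => P D uP realD defB.
have /fin_all_exists [e De] : forall i, exists x : R, D ord0 i = real_complex R x.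
  by move=> i; have /mxOverP/(_ ord0 i)/complex_realP := realD.
pose d : 'rV[R]_n := \row_i e i.
have {}De : D = map_mx (real_complex R) d.
  by apply/matrixP => i j; rewrite (ord1 i) !mxE.
exists d; split.
- apply: (map_poly_inj (real_complex R)).
  rewrite map_char_poly -/B defB char_poly_conj // char_poly_trig;
    last exact: diag_mx_is_trig.
  rewrite rmorph_prod; apply: eq_bigr => i _.
  by rewrite De rmorphB /= map_polyX map_polyC !mxE eqxx.
- apply: (@complexI R).
  rewrite -[LHS]trace_map_mx -/B defB mxtrace_mulC mulKVmx //.
  by rewrite De -map_diag_mx trace_map_mx mxtrace_diag.
- apply: (@complexI R); rewrite -[LHS]trace_map_mx map_mxM -/B defB.
  rewrite -!mulmxA mulKVmx // mxtrace_mulC !mulmxA mulmxK //.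
  rewrite mulmx_diag mxtrace_diag.
  by rewrite rmorph_sum; apply: eq_bigr => i _; rewrite De !mxE rmorphXn expr2.
Qed.

(** * The variance of a weighted Laplacian *)

Lemma SL_mul_ones (R : realType) (n : nat) (G : sgraph n) (A : 'M[R]_n) :
  SL G A -> const_mx 1 *m A = 0 :> 'rV[R]_n.
Proof.
case=> symA _ _ diagA; apply/rowP => i; rewrite !mxE.
rewrite (eq_bigr (A i)) => [|j _]; last by rewrite mxE mul1r -{1}symA mxE.
by rewrite (bigD1 i) //= diagA addNr.
Qed.

(** The diagonal entries [d] make the defining property of [spectrum A]
    inhabited; two monic split polynomials that agree have the same roots with
    multiplicity, so [spectrum A] is a rearrangement of [d]. *)
Lemma nontriv_eigenvalues_spec (R : realType) (n : nat) (A : 'M[R]_n) :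
  A^T = A -> eigenvalue A 0 -> exists d : 'rV[R]_n,
    [/\ perm_eq (0 :: nontriv_eigenvalues A) (codom (d ord0)),
        \tr A = \sum_i d ord0 i
      & \tr (A *m A) = \sum_i d ord0 i ^+ 2].
Proof.
move=> symA eig0; have [d [charA trA trA2]] := spectral_real_sym symA.
exists d; split=> //.
have [_ defA] : sorted <=%R (spectrum A) /\
    char_poly A = \prod_(x <- spectrum A) ('X - x%:P).
  apply: (@xgetPex _ [::] [set s : seq R | sorted <=%R s /\
    char_poly A = \prod_(x <- s) ('X - x%:P)]).
  (* Any list of roots does; sorting it gives the required order. *)
  exists (sort <=%R (codom (d ord0))); split; first exact/sort_sorted/le_total.
  rewrite charA (perm_big (codom (d ord0))) ?perm_sort //=.
  by rewrite big_map big_enum.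
have spec0 : 0 \in spectrum A.
  by rewrite -root_prod_XsubC -defA -eigenvalue_root_char.
rewrite -(permPl (perm_to_rem spec0)); apply: prod_XsubC_eq.
by rewrite -defA charA big_map big_enum.
Qed.

Lemma mean_sqr_dev (F : numFieldType) (s : seq F) (k := (size s)%:R : F)
    (mu := k^-1 * \sum_(x <- s) x) : (0 < size s)%N ->
  k^-1 * \sum_(x <- s) (x - mu) ^+ 2 = k^-1 * (\sum_(x <- s) x ^+ 2) - mu ^+ 2.
Proof.
move=> s_gt0; have k0 : k != 0 by rewrite pnatr_eq0 -lt0n.
have -> : \sum_(x <- s) (x - mu) ^+ 2 =
    \sum_(x <- s) x ^+ 2 - 2 * mu * \sum_(x <- s) x + k * mu ^+ 2.
  rewrite /k -sum1_size natr_sum mulr_suml mulr_sumr -sumrB -big_split /=.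
  by apply: eq_bigr => x _; ring.
by rewrite /mu; field.
Qed.

(** The removed eigenvalue is [0], with the all-ones vector as eigenvector, so
    both power sums over the remaining ones are traces. *)
Lemma Var_trace (R : realType) (n : nat) (G : sgraph n) (A : 'M[R]_n) :
  (2 <= n)%N -> SL G A ->
  Var A = (n.-1)%:R^-1 * \tr (A *m A) - ((n.-1)%:R^-1 * \tr A) ^+ 2.
Proof.
move=> n2 SLA; have [symA _ _ _] := SLA.
have eig0 : eigenvalue A 0.
  apply/eigenvalueP; exists (const_mx 1).
    by rewrite scale0r (SL_mul_ones SLA).
  apply/eqP => /rowP /(_ (Ordinal (ltnW n2))); rewrite !mxE => /eqP.
  by rewrite oner_eq0.
have [d [perm_d -> ->]] := nontriv_eigenvalues_spec symA eig0.
have sum_d (f : R -> R) : \sum_i f (d ord0 i) =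
    f 0 + \sum_(x <- nontriv_eigenvalues A) f x.
  transitivity (\sum_(x <- 0 :: nontriv_eigenvalues A) f x);
    last by rewrite big_cons.
  by rewrite (perm_big _ perm_d) big_map big_enum.
have size_eig : size (nontriv_eigenvalues A) = n.-1.
  apply: succn_inj.
  rewrite prednK 1?ltnW // -[LHS]/(size (0 :: nontriv_eigenvalues A)).
  by rewrite (perm_size perm_d) size_codom card_ord.
have sum_id := sum_d id; have sum_sqr := sum_d (fun x => x ^+ 2).
rewrite sum_id sum_sqr expr0n !add0r -size_eig -mean_sqr_dev ?size_eig //.
by case: (n) n2 => [|[]].
Qed.

(** * Bounds on the trace of the square *)

Definition deg (n : nat) (G : sgraph n) (i : 'I_n) : nat := \sum_j G i j.

(** Handshake lemma: the map that sends an ordered adjacent pair to its edge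
    has fibers of size two. *)
Lemma sum_deg (n : nat) (G : sgraph n) :
  (\sum_i deg G i = 2 * #|edges G|)%N.
Proof.
transitivity (\sum_(p : 'I_n * 'I_n | p \in [pred p | G p.1 p.2]) 1)%N.
  by rewrite /deg pair_big [RHS]big_mkcond; apply: eq_bigr => p _.
rewrite (partition_big_imset (fun p : 'I_n * 'I_n => [set p.1; p.2]%SET)) /=.
rewrite -/(edges G) mulnC -sum_nat_const.
apply: eq_bigr => e /imsetP [[a b] /= Gab ->].
have {}Gab : G a b by [].
have ab : a != b by apply: contraTneq Gab => ->; rewrite adj_irr.
have pab : (a, b) != (b, a) by rewrite xpair_eqE negb_and ab.
transitivity #|[set (a, b); (b, a)]%SET|; last by rewrite cards2 pab.
rewrite sum1dep_card; apply: eq_card => -[c d].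
rewrite !inE /=; apply/andP/orP => [[Gcd /eqP eq_cd]|].
  have cd : c != d by apply: contraTneq Gcd => ->; rewrite adj_irr.
  have : (c \in [set a; b]%SET) && (d \in [set a; b]%SET).
    by rewrite -eq_cd !inE !eqxx orbT.
  by rewrite !inE => /andP[/pred2P[]Ec /pred2P[]Ed]; subst c d;
    rewrite ?eqxx in cd *; [|left|right|].
by case=> /eqP[-> ->]; split=> //; [rewrite adj_sym | rewrite finset.setUC].
Qed.

(** Termwise, [(A i i - 2) ^ 2 >= 0] on the diagonal and
    [(A i j + 1) ^ 2 >= 0] on the edges; the linear terms off the diagonal add
    up to [2 * A i i] because the row sums to [0]. *)
Lemma sum_row (R : realType) (n : nat) (G : sgraph n) (A : 'M[R]_n) (i : 'I_n) :
  SL G A -> 6 * A i i - 4 - (deg G i)%:R <= \sum_j A i j ^+ 2.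
Proof.
case=> _ _ A0 diagA.
rewrite /deg natr_sum (bigD1 i) //= adj_irr add0r [leRHS](bigD1 i) //=.
have -> : 6 * A i i - 4 - \sum_(j | j != i) (G i j)%:R =
    (4 * A i i - 4) + \sum_(j | j != i) (- 2 * A i j - (G i j)%:R).
  by rewrite big_split /= -mulr_sumr sumrN (diagA i); ring.
apply: lerD; first by have := sqr_ge0 (A i i - 2); nra.
apply: ler_sum => j ji; case Gij : (G i j).
  by rewrite mulr1n; have := sqr_ge0 (A i j + 1); nra.
by rewrite A0 1?eq_sym ?Gij // expr0n mulr0 subr0.
Qed.

Lemma tr_sqr_sym (R : realType) (n : nat) (A : 'M[R]_n) :
  A^T = A -> \tr (A *m A) = \sum_i \sum_j A i j ^+ 2.
Proof.
move=> symA; apply: eq_bigr => i _; rewrite mxE; apply: eq_bigr => j _.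
by rewrite -{2}symA mxE expr2.
Qed.

Lemma tr_sqr_ge (R : realType) (n : nat) (G : sgraph n) (A : 'M[R]_n) :
  SLs G A -> 10 * #|edges G|%:R - 4 * n%:R <= \tr (A *m A).
Proof.
case=> SLA trA; have [symA _ _ _] := SLA; rewrite tr_sqr_sym //.
apply: le_trans (ler_sum _ (fun i _ => sum_row i SLA)).
rewrite !sumrB -mulr_sumr -/(\tr A) trA sumr_const card_ord -natr_sum sum_deg.
by rewrite natrM -[4 *+ n]mulr_natr; lra.
Qed.

Definition laplacian (R : realType) (n : nat) (G : sgraph n) : 'M[R]_n :=
  diag_mx (\row_i (deg G i)%:R) - adjacency_mx R G.

Lemma laplacian_SLs (R : realType) (n : nat) (G : sgraph n) : SLs G (laplacian R G).
Proof.
split; last first.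
  rewrite -sum_deg natr_sum; apply: eq_bigr => i _.
  by rewrite !mxE eqxx adj_irr subr0.
split.
- apply/matrixP => i j; rewrite !mxE adj_sym; case: eqVneq => [->|];
    by rewrite // eq_sym => /negbTE ->.
- move=> i j Gij; rewrite !mxE Gij; case: eqVneq Gij => [->|_ _].
    by rewrite adj_irr.
  by rewrite mulr0n sub0r oppr_lt0 ltr01.
- by move=> i j /negbTE ij /negbTE Gij; rewrite !mxE ij Gij subr0.
- move=> i; rewrite !mxE eqxx adj_irr subr0 mulr1n natr_sum.
  rewrite (bigD1 i) //= adj_irr add0r -sumrN.
  by apply: eq_bigr => j ji; rewrite !mxE eq_sym (negbTE ji) sub0r opprK.
Qed.

Lemma tr_sqr_laplacian (R : realType) (n : nat) (G : sgraph n) :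
  \tr (laplacian R G *m laplacian R G) = (\sum_i deg G i ^ 2 + 2 * #|edges G|)%:R.
Proof.
have [[symL _ _ _] _] := laplacian_SLs R G.
rewrite tr_sqr_sym // -sum_deg -big_split natr_sum; apply: eq_bigr => i _ /=.
rewrite natrD natrX (bigD1 i) //= !mxE eqxx adj_irr subr0 mulr1n; congr (_ + _).
rewrite natr_sum [RHS](bigD1 i) //= adj_irr add0r; apply: eq_bigr => j ji.
rewrite !mxE eq_sym (negbTE ji) sub0r sqrrN.
by case: (G i j); rewrite ?expr1n ?expr0n.
Qed.

(** * The minimum variance *)

(** With [n - 1] edges, as in a tree, the number of edges equals the number of
    nontrivial eigenvalues, so that their mean is [2]. *)
Lemma mv_ge (R : realType) (n : nat) (G : sgraph n) :
  (2 <= n)%N -> #|edges G| = n.-1 -> 2 - 4 / (n.-1)%:R <= mv R G.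
Proof.
move=> n2 cardE; apply: lb_le_inf.
  exists (Var (laplacian R G)).
  by exists (laplacian R G) => //; apply: laplacian_SLs.
move=> _ [A SLsA <-]; have [SLA trA] := SLsA.
rewrite (Var_trace (G := G)) // trA cardE natrM.
have En : n%:R = n.-1%:R + 1 :> R by rewrite natr1 prednK // ltnW.
have := tr_sqr_ge SLsA; rewrite cardE En.
have : (0 : R) < n.-1%:R by rewrite ltr0n -subn1 subn_gt0.
move: (n.-1%:R) => N N0 trA2.
have -> : N^-1 * (2 * N) = 2 by field; rewrite gt_eqF.
rewrite lerBrDr -(ler_pM2l N0) mulrA divff ?gt_eqF // mul1r.
suff -> : N * (2 - 4 / N + 2 ^+ 2) = 10 * N - 4 * (N + 1) by [].
by field; rewrite gt_eqF.
Qed.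

Lemma mv_le (R : realType) (n : nat) (G : sgraph n) :
  (2 <= n)%N -> #|edges G| = n.-1 -> (forall i, deg G i <= 2)%N -> mv R G <= 2.
Proof.
move=> n2 cardE deg2.
apply: (@le_trans _ _ (Var (laplacian R G))).
  apply: ge_inf; last first.
    by exists (laplacian R G) => //; apply: laplacian_SLs.
  exists 0 => _ [A _ <-].
  rewrite /Var mulr_ge0 ?invr_ge0 ?ler0n // sumr_ge0 // => x _.
  exact: sqr_ge0.
have [SLL trL] := laplacian_SLs R G.
have leS : \tr (laplacian R G *m laplacian R G) <= 6 * n.-1%:R.
  rewrite tr_sqr_laplacian -natrM ler_nat cardE.
  rewrite (_ : 6 = 4 + 2)%N // mulnDl leq_add2r.
  rewrite (_ : 4 = 2 * 2)%N // -mulnA -cardE -sum_deg big_distrr /=.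
  by apply: leq_sum => i _; rewrite leq_mul2r deg2 orbT.
rewrite (Var_trace (G := G)) // trL cardE natrM.
have : (0 : R) < n.-1%:R by rewrite ltr0n -subn1 subn_gt0.
move: (n.-1%:R) (\tr _) leS => N S leS N0.
have -> : N^-1 * (2 * N) = 2 by field; rewrite gt_eqF.
by rewrite lerBlDr -(ler_pM2l N0) mulrA divff ?gt_eqF // mul1r; lra.
Qed.

(** * The path *)

(** An injective labelling [f] of the vertices turns a bound on the number of
    neighbours into a list of the labels that they may carry. For the path the
    label is the vertex number, for its line graph it is the edge. *)
Lemma deg_le2 (n : nat) (G : sgraph n) (T : eqType) (f : 'I_n -> T) (i : 'I_n)
    (x y : T) :
  injective f -> (forall j, G i j -> f j \in [:: x; y]) -> (deg G i <= 2)%N.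
Proof.
move=> inj_f nbr.
have -> : deg G i = size (map f (enum (G i))).
  by rewrite size_map -cardE -sum1_card [RHS]big_mkcond; apply: eq_bigr.
apply: (@uniq_leq_size _ _ [:: x; y]); first by rewrite map_inj_uniq ?enum_uniq.
by move=> _ /mapP[j + ->]; rewrite mem_enum; apply: nbr.
Qed.

(** The edge [{i, i + 1}], for a natural number [i] so that the neighbours
    [i.+1] and [i.-1] can be named without bounds. *)
Definition path_edge (n i : nat) : {set 'I_n} :=
  [set v : 'I_n | (v == i :> nat) || (v == i.+1 :> nat)]%SET.

Lemma path_edge_inj (n i j : nat) :
  (i.+1 < n)%N -> (j.+1 < n)%N -> path_edge n i = path_edge n j -> i = j.
Proof.
move=> lt_i lt_j /setP eq_ij.
have := eq_ij (Ordinal (ltnW lt_i)); have := eq_ij (Ordinal (ltnW lt_j)).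
rewrite !inE /=; lia.
Qed.

Lemma edges_path (n : nat) :
  edges (path_graph n.+1) = [set path_edge n.+1 i | i : 'I_n]%SET.
Proof.
have pair_edge (v w : 'I_n.+1) : v.+1 = w -> [set v; w]%SET = path_edge n.+1 v.
  by move=> vw; apply/setP => u; rewrite !inE -!val_eqE /= vw.
apply/setP => e; apply/imsetP/imsetP => [[[v w] /= vw ->]|[i _ ->]].
  wlog {vw}vw : v w / v.+1 = w.
    move=> wl; have /orP[/eqP/wl//|/eqP/wl] : path_rel v w by [].
    by rewrite finset.setUC.
  have lt_v : (v < n)%N by rewrite -ltnS vw ltn_ord.
  by exists (Ordinal lt_v); rewrite ?pair_edge.
exists (widen_ord (leqnSn n) i, lift ord0 i); rewrite ?pair_edge //.
by rewrite inE /= /path_rel /= eqxx.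
Qed.

Lemma card_edges_path (n : nat) : #|edges (path_graph n)| = n.-1.
Proof.
case: n => [|n]; last first.
  rewrite edges_path card_imset ?card_ord // => i j /path_edge_inj ij.
  by apply/val_inj/ij; rewrite ltnS ltn_ord.
by apply: eq_card0 => e; apply/imsetP => -[[[]]].
Qed.

Lemma deg_path (n : nat) (i : 'I_n) : (deg (path_graph n) i <= 2)%N.
Proof.
apply: (@deg_le2 _ _ _ val i i.+1 i.-1 val_inj) => j.
by rewrite !inE => /orP[/eqP|/eqP<-]; rewrite ?eqxx ?orbT // => ->; rewrite eqxx.
Qed.

(** An edge that meets [path_edge n i] without being equal to it is the next
    or the previous one. *)
Lemma deg_line_path (n : nat) (k : 'I_#|edges (path_graph n)|) :
  (deg (line_graph (path_graph n)) k <= 2)%N.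
Proof.
case: n k => [|n] k; first by have := enum_valP k => /imsetP[[[]]].
have edgeP (l : 'I_#|edges (path_graph n.+1)|) :
    exists i : 'I_n, enum_val l = path_edge n.+1 i.
  suff /imsetP[i _ ->] : enum_val l \in [set path_edge n.+1 i | i : 'I_n]%SET.
    by exists i.
  by rewrite -edges_path; apply: enum_valP.
have [i def_k] := edgeP k.
apply: (@deg_le2 _ _ _ enum_val k (path_edge n.+1 i.+1) (path_edge n.+1 i.-1)).
  exact: enum_val_inj.
move=> l /andP[]; rewrite -(inj_eq enum_val_inj) def_k.
have [j ->] := edgeP l => neq_ij /finset.set0Pn[v].
rewrite !inE => /andP[iv jv].
have ij : i != j :> nat by apply: contraNneq neq_ij => ->.
have : j = i.+1 :> nat \/ j = i.-1 :> nat by lia.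
by case=> ->; rewrite eqxx ?orbT.
Qed.

(** * Eligibility *)

(** Compare the two sides in a row where [y] has the largest absolute value
    [c]: the diagonal contributes [4 * c] and the rest at most [2 * c]. *)
Lemma four_plus_bound (R : realFieldType) (n : nat) (B : 'M[R]_n) (y : 'cV[R]_n)
    (b : R) :
  (forall i j, 0 <= B i j) -> (forall i, \sum_j B i j <= 2) ->
  (forall i, `|((4%:M + B) *m y) i ord0| <= b) -> forall i, `|y i ord0| <= b / 2.
Proof.
move=> B0 B2 yb i0.
pose i := [arg max_(i > i0) `|y i ord0|]%O.
have le_i j : `|y j ord0| <= `|y i ord0|.
  by rewrite /i; case: arg_maxP => // k _; apply.
apply: le_trans (le_i i0) _.
have By : `|(B *m y) i ord0| <= 2 * `|y i ord0|.
  rewrite mxE (le_trans (ler_norm_sum _ _ _)) //.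
  apply: le_trans (_ : (\sum_j B i j) * `|y i ord0| <= _); last exact: ler_wpM2r.
  rewrite mulr_suml; apply: ler_sum => j _.
  by rewrite normrM (ger0_norm (B0 _ _)) ler_wpM2l.
have := yb i; rewrite mulmxDl mul_scalar_mx mxE [_ i ord0]mxE.
have := ler_normB (4 * y i ord0 + (B *m y) i ord0) ((B *m y) i ord0).
rewrite addrK normrM ger0_norm //; lra.
Qed.

Lemma four_plus_unit (R : realFieldType) (n : nat) (B : 'M[R]_n) :
  (forall i j, 0 <= B i j) -> (forall i, \sum_j B i j <= 2) ->
  4%:M + B \in unitmx.
Proof.
move=> B0 B2; rewrite unitmxE -det_tr unitfE; apply/negP => /det0P[v v0 vM].
case/eqP: v0; apply/rowP => i.
have := @four_plus_bound _ _ B v^T 0 B0 B2 _ i.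
rewrite mul0r normr_le0 !mxE => /(_ _)/eqP-> //.
by move=> j; rewrite -[_ + B]trmxK -trmx_mul vM !mxE normr0.
Qed.

(** Each row reads [4 * y i = 1 - \sum_j B i j * y j]. If
    [y <= c] with [0 <= c], then [4 * y >= 1 - 2 * c]; taking [c = 1 / 2] gives
    [y >= 0], which improves the bound to [c = 1 / 4], and this one is enough. *)
Lemma four_plus_pos (R : realFieldType) (n : nat) (B : 'M[R]_n) (i : 'I_n) :
  (forall i j, 0 <= B i j) -> (forall i, \sum_j B i j <= 2) ->
  0 < (invmx (4%:M + B) *m const_mx 1 : 'cV[R]_n) i ord0.
Proof.
move=> B0 B2; set y := invmx _ *m _.
have My : (4%:M + B) *m y = const_mx 1 by rewrite mulKVmx ?four_plus_unit.
have y_half j : `|y j ord0| <= 1 / 2.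
  by apply: four_plus_bound j => // j; rewrite My mxE normr1.
have yE j : 4 * y j ord0 + \sum_k B j k * y k ord0 = 1.
  by have /colP/(_ j) := My; rewrite mulmxDl mul_scalar_mx !mxE.
have sum_le (c : R) : 0 <= c -> (forall j, y j ord0 <= c) ->
    forall j, \sum_k B j k * y k ord0 <= 2 * c.
  move=> c0 yc j; apply: le_trans (_ : (\sum_k B j k) * c <= _); last exact: ler_wpM2r.
  by rewrite mulr_suml; apply: ler_sum => k _; apply: ler_wpM2l.
have y_ge0 j : 0 <= y j ord0.
  have := sum_le (1 / 2) _ (fun k => le_trans (ler_norm _) (y_half k)) j.
  by have := yE j; lra.
have y_le j : y j ord0 <= 1 / 4.
  have : 0 <= \sum_k B j k * y k ord0.
    by apply: sumr_ge0 => k _; apply: mulr_ge0.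
  by have := yE j; lra.
have := yE i; have := sum_le (1 / 4) _ y_le i; lra.
Qed.

Lemma eligible_line_deg (R : realType) (n : nat) (G : sgraph n) :
  (forall k, deg (line_graph G) k <= 2)%N -> eligible R G.
Proof.
move=> deg2 k; apply: four_plus_pos => [i j|i]; first by rewrite mxE ler0n.
under eq_bigr do rewrite mxE.
by rewrite -natr_sum ler_nat deg2.
Qed.

Theorem theorem4p12 (R : realType) :
  (forall n : nat, (2 <= n)%N -> eligible R (path_graph n)) /\
  (fun n : nat => mv R (path_graph n)) @ \oo --> (2 : R).
Proof.
split=> [n _|]; first exact/eligible_line_deg/deg_line_path.
(* The shift replaces [n - 1] by [n.+1], whose inverse is [harmonic n]. *)
rewrite -(cvg_shiftn 2).
apply: (@squeeze_cvgr _ _ _ _ (fun n => 2 - 4 * harmonic n) (fun=> 2)).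
- apply: nearW => n; rewrite /= addn2; apply/andP; split.
    exact: (@mv_ge R n.+2 _ isT (card_edges_path _)).
  by apply: mv_le => [||i] //; [exact: card_edges_path | exact: deg_path].
- rewrite -[X in _ --> X]subr0 -[X in _ --> _ - X](mulr0 4).
  by apply: cvgB; [apply: cvg_cst | apply: cvgMr; apply: cvg_harmonic].
- exact: cvg_cst.
Qed.
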